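(* Assume that $\Theta(\xi)\neq0$ for any $\xi\in(0,L)$ (which means that the upper wall function $\varphi_{\mathrm w}$ is strictly monotone in $(0,L)$, and the nozzle is either expanding or contracting). Let $R(\xi)=\int_0^L\Theta(\tau)\,d\tau-\dot K\int_0^\xi\Theta(\tau)\,d\tau$ for $\xi\in(0,L)$, $\underline R=\inf_{\xi\in(0,L)}R(\xi)$, $\overline R=\sup_{\xi\in(0,L)}R(\xi)$, and $$\dot P_*=\frac1{\bar\rho_+\bar q_+}\cdot\frac{1-\bar M_+^2}{\bar\rho_+\bar q_+^2}\int_0^1P(\eta)\,d\eta .$$ Then there exists a unique solution $\bar\xi_*\in(0,L)$ to the equation $$\frac1{\bar\rho_+\bar q_+}\cdot\frac{1-\bar M_+^2}{\bar\rho_+\bar q_+^2}\int_0^1P(\eta)\,d\eta=\int_0^L\Theta(\xi)\,d\xi-\dot K\int_0^{\bar\xi_*}\Theta(\xi)\,d\xi$$ (that is, $R(\bar\xi_* )=\dot P_*$), provided that $\underline R\le\dot P_*\le\overline R$. Furthermore, the solution $\bar\xi_*$ satisfies $R'(\bar\xi_* )=-\dot K\,\Theta(\bar\xi_* )\neq0$.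
   Context: $L>0$, $0<\alpha<1$, $P\in C^{2,\alpha}([0,\infty))$ with finite norm, $\Theta\in C^{2,\alpha}([0,L])$ with $\|\Theta\|_{C^{2,\alpha}}=1$, $\Theta(0)=\Theta'(0)=\Theta''(0)=0$. The upper nozzle wall is $y=\varphi_{\mathrm w}(x)=1+\int_0^x\tan(\sigma\Theta(s))\,ds$ for a small $\sigma>0$. The gas is polytropic with exponent $\gamma>1$: $p=(\gamma-1)e^{(S-S_0)/c_v}\rho^\gamma$, sound speed $c=\sqrt{\gamma p/\rho}$, Mach number $M=q/c$. The background states $\bar U_\pm=(\bar p_\pm,0,\bar q_\pm,\bar S_\pm)$ (pressure, flow angle, speed, entropy) are constant, with $\bar M_->1>\bar M_+$, satisfy the normal shock relations $[\bar\rho\bar q]=[\bar\rho\bar q^2+\bar p]=[\frac12\bar q^2+\frac{\gamma\bar p}{(\gamma-1)\bar\rho}]=0$, $[\bar p]=\bar p_+-\bar p_->0$ ($[\cdot]$ is the $+$ value minus the $-$ value), and are normalized so that $\bar\rho_\pm\bar q_\pm=1$. The constant $\dot K$ is $\dot K=[\bar p]\big(\frac{\gamma-1}{\gamma\bar p_+}+\frac1{\bar\rho_+\bar q_+^2}\big)>0$.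
   Formalization: The unique solution in the open interval (0,L) is claimed only when both inequalities are strict, since R is strictly monotone and never attains its inf or sup there; under the non-strict inequalities a unique solution in [0,L] is claimed. R' = -K̇Θ ≠ 0 is stated for solutions in (0,L). *)

(* Defs.v *)
From Stdlib Require Import Reals.
From Coquelicot Require Import Coquelicot.

Open Scope R_scope.

(** * Hölder spaces C^{2,alpha} on a subset of the line *)

Definition closed_seg (a b x : R) : Prop := a <= x <= b.
Definition half_line (a x : R) : Prop := a <= x.

(** [D_in f (fun _ => l) D x] is the limit of the difference quotient taken
    inside [D]; on an interval it is the one-sided derivative at the end points,
    and the values of [f] outside [D] play no role. *)
Definition ex_derive_on (D : R -> Prop) (f : R -> R) (x : R) : Prop :=
  exists l : R, D_in f (fun _ => l) D x.

Definition derive_on (D : R -> Prop) (f : R -> R) (x : R) : R :=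
  iota (fun l : R => D_in f (fun _ => l) D x).

Definition sup_norm (D : R -> Prop) (f : R -> R) : Rbar :=
  Lub_Rbar (fun v => exists x, D x /\ v = Rabs (f x)).

Definition holder_seminorm (D : R -> Prop) (alpha : R) (f : R -> R) : Rbar :=
  Lub_Rbar (fun v => exists x y, D x /\ D y /\ x <> y /\
                       v = Rabs (f x - f y) / Rpower (Rabs (x - y)) alpha).

Definition C2alpha_norm (D : R -> Prop) (alpha : R) (f : R -> R) : Rbar :=
  let f1 := derive_on D f in
  let f2 := derive_on D f1 in
  Rbar_plus (Rbar_plus (Rbar_plus (sup_norm D f) (sup_norm D f1)) (sup_norm D f2))
            (holder_seminorm D alpha f2).

(** Continuity of the second derivative follows from the finite seminorm. *)
Definition C2alpha (D : R -> Prop) (alpha : R) (f : R -> R) : Prop :=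
  (forall x, D x -> ex_derive_on D f x) /\
  (forall x, D x -> ex_derive_on D (derive_on D f) x) /\
  is_finite (C2alpha_norm D alpha f).

(** * Polytropic gas and the background normal shock *)

(** The density is carried along with (p, theta, q, S); it is determined by
    [p] and [S] through [polytropic]. *)
Record gas_state : Type := GasState {
  pressure : R;
  flow_angle : R;
  speed : R;
  entropy : R;
  density : R
}.

Definition polytropic (gamma cv S0 : R) (U : gas_state) : Prop :=
  0 < density U /\
  pressure U =
    (gamma - 1) * exp ((entropy U - S0) / cv) * Rpower (density U) gamma.

Definition sound_speed (gamma : R) (U : gas_state) : R :=
  sqrt (gamma * pressure U / density U).

Definition mach (gamma : R) (U : gas_state) : R :=
  speed U / sound_speed gamma U.

Definition mass_flux (U : gas_state) : R := density U * speed U.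

Definition momentum_flux (U : gas_state) : R :=
  density U * speed U ^ 2 + pressure U.

Definition bernoulli (gamma : R) (U : gas_state) : R :=
  / 2 * speed U ^ 2 + gamma * pressure U / ((gamma - 1) * density U).

Definition jump (g : gas_state -> R) (Um Up : gas_state) : R := g Up - g Um.

Record background_shock (gamma cv S0 : R) (Um Up : gas_state) : Prop := {
  bs_polytropic_m : polytropic gamma cv S0 Um;
  bs_polytropic_p : polytropic gamma cv S0 Up;
  bs_angle_m : flow_angle Um = 0;
  bs_angle_p : flow_angle Up = 0;
  bs_supersonic : mach gamma Um > 1;
  bs_subsonic : 1 > mach gamma Up;
  bs_mass : jump mass_flux Um Up = 0;
  bs_momentum : jump momentum_flux Um Up = 0;
  bs_bernoulli : jump (bernoulli gamma) Um Up = 0;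
  bs_pressure_jump : jump pressure Um Up > 0;
  bs_normalized_m : mass_flux Um = 1;
  bs_normalized_p : mass_flux Up = 1
}.

Definition Kdot (gamma : R) (Um Up : gas_state) : R :=
  jump pressure Um Up *
  ((gamma - 1) / (gamma * pressure Up) + 1 / (density Up * speed Up ^ 2)).

(** * The equation for the shock position *)

Definition Rfun (L K : R) (Theta : R -> R) (xi : R) : R :=
  RInt Theta 0 L - K * RInt Theta 0 xi.

Definition inf_open (L : R) (f : R -> R) : Rbar :=
  Glb_Rbar (fun v => exists xi, 0 < xi < L /\ v = f xi).

Definition sup_open (L : R) (f : R -> R) : Rbar :=
  Lub_Rbar (fun v => exists xi, 0 < xi < L /\ v = f xi).

Definition Pdot_star (gamma : R) (Up : gas_state) (P : R -> R) : R :=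
  1 / (density Up * speed Up) *
  ((1 - mach gamma Up ^ 2) / (density Up * speed Up ^ 2)) * RInt P 0 1.

(* Main.v *)
Require Import Defs.
From Stdlib Require Import Reals Lra.
From Coquelicot Require Import Coquelicot.

Open Scope R_scope.

(** The function [Rfun L K Theta] is differentiable on (0, L) with derivative
    [- K * Theta], by the fundamental theorem of calculus, and this derivative has
    no zero there because [Theta] has none and [K > 0] ([Kdot_pos]).  By the mean
    value theorem it is therefore injective on [0, L].  A continuous injective
    function on a closed segment takes its values between those at the end points
    ([injective_between_endpoints]), so its infimum and supremum over the open
    interval are bounded by these end values; the intermediate value theorem then
    gives a point at which the required level is reached.  When the level lies
    strictly between the infimum and the supremum, that point is not an end point.

    Since [Theta] is regular only relatively to [0, L], it is first replaced by the
    continuous function on the whole line that is constant outside [0, L] and agrees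
    with [Theta] inside ([clamp], [continuous_clamp]); the integrals involved are
    unchanged. *)

(** Projection of the real line onto the segment [a, b] (for [a <= b]). *)
Definition clamp (a b x : R) : R := Rmax a (Rmin b x).

Lemma clamp_in (a b x : R) : a <= b -> a <= clamp a b x <= b.
Proof.
  intros hab; unfold clamp, Rmax, Rmin; destruct (Rle_dec b x);
    match goal with |- context [Rle_dec ?u ?v] => destruct (Rle_dec u v) end; lra.
Qed.

Lemma clamp_id (a b x : R) : a <= x <= b -> clamp a b x = x.
Proof.
  intros hx; unfold clamp; rewrite Rmin_right by lra; apply Rmax_right; lra.
Qed.

Lemma clamp_lipschitz (a b x y : R) :
  Rabs (clamp a b x - clamp a b y) <= Rabs (x - y).
Proof.
  unfold clamp, Rmax, Rmin; destruct (Rle_dec b x); destruct (Rle_dec b y);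
    repeat match goal with |- context [Rle_dec ?u ?v] => destruct (Rle_dec u v) end;
    unfold Rabs; repeat destruct Rcase_abs; lra.
Qed.

Lemma continuous_clamp (a b : R) (f : R -> R) :
  a <= b -> (forall x, a <= x <= b -> continue_in f (closed_seg a b) x) ->
  continuity (fun x => f (clamp a b x)).
Proof.
  intros hab hf x eps heps.
  destruct (hf _ (clamp_in a b x hab) eps heps) as [d [hd H]].
  exists d; split; [exact hd|].
  intros y [_ hy].
  destruct (Req_dec (clamp a b y) (clamp a b x)) as [e | ne].
  - rewrite e; simpl; rewrite Rdist_eq; exact heps.
  - apply H; split.
    + split; [exact (clamp_in a b y hab) | intro e; apply ne; symmetry; exact e].
    + simpl in *; unfold Rdist in *.
      apply Rle_lt_trans with (2 := hy); apply clamp_lipschitz.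
Qed.

(** If a value exceeded both end values, the larger end value would be taken a
    second time between this point and the opposite end. *)
Lemma injective_le_Rmax (f : R -> R) (a b x : R) :
  continuity f ->
  (forall u v, a <= u <= b -> a <= v <= b -> f u = f v -> u = v) ->
  a < x < b -> f x <= Rmax (f a) (f b).
Proof.
  intros hc hinj hx.
  destruct (Rle_lt_dec (f x) (Rmax (f a) (f b))) as [h | h]; [exact h | exfalso].
  pose proof (Rmax_l (f a) (f b)); pose proof (Rmax_r (f a) (f b)).
  destruct (Rle_dec (f a) (f b)) as [hab | hab].
  - destruct (IVT_gen f a x (f b) hc) as [z [hz e]].
    { rewrite Rmin_left, Rmax_right by lra; lra. }
    rewrite Rmin_left, Rmax_right in hz by lra.
    assert (z = b) by (apply hinj; lra); lra.
  - destruct (IVT_gen f x b (f a) hc) as [z [hz e]].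
    { rewrite Rmin_right, Rmax_left by lra; lra. }
    rewrite Rmin_left, Rmax_right in hz by lra.
    assert (z = a) by (apply hinj; lra); lra.
Qed.

Lemma injective_between_endpoints (f : R -> R) (a b x : R) :
  continuity f ->
  (forall u v, a <= u <= b -> a <= v <= b -> f u = f v -> u = v) ->
  a < x < b -> Rmin (f a) (f b) <= f x <= Rmax (f a) (f b).
Proof.
  intros hc hinj hx; split; [| now apply injective_le_Rmax].
  assert (h : - f x <= Rmax (- f a) (- f b)).
  { apply (injective_le_Rmax (fun t => - f t) a b x); [| | exact hx].
    - apply continuity_opp; exact hc.
    - intros u v hu hv e; apply hinj; [exact hu | exact hv | lra]. }
  rewrite <- Ropp_Rmin in h; lra.
Qed.

Lemma injective_of_derive_neq0 (f df : R -> R) (a b : R) :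
  (forall x, is_derive f x (df x)) ->
  (forall x, a < x < b -> df x <> 0) ->
  forall u v, a <= u <= b -> a <= v <= b -> f u = f v -> u = v.
Proof.
  intros hd hn.
  assert (Rolle_lt : forall u v, a <= u -> v <= b -> u < v -> f u <> f v).
  { intros u v hu hv huv e.
    destruct (MVT_cor2 f df u v huv) as [c [hc1 hc2]].
    { intros c _; apply is_derive_Reals, hd. }
    assert (hz : df c * (v - u) = 0) by lra.
    apply Rmult_integral in hz; destruct hz as [hz | hz]; [| lra].
    revert hz; apply hn; lra. }
  intros u v hu hv e.
  destruct (Rtotal_order u v) as [h | [h | h]]; [| exact h |]; exfalso.
  - apply (Rolle_lt u v); lra.
  - apply (Rolle_lt v u); lra.
Qed.

Lemma inf_open_ge (L m : R) (f : R -> R) :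
  (forall x, 0 < x < L -> m <= f x) -> Rbar_le m (inf_open L f).
Proof.
  intros h; unfold inf_open.
  destruct (Glb_Rbar_correct (fun v => exists xi, 0 < xi < L /\ v = f xi)) as [_ H].
  apply H; intros v [x [hx ->]]; simpl; apply h; exact hx.
Qed.

Lemma sup_open_le (L m : R) (f : R -> R) :
  (forall x, 0 < x < L -> f x <= m) -> Rbar_le (sup_open L f) m.
Proof.
  intros h; unfold sup_open.
  destruct (Lub_Rbar_correct (fun v => exists xi, 0 < xi < L /\ v = f xi)) as [_ H].
  apply H; intros v [x [hx ->]]; simpl; apply h; exact hx.
Qed.

Lemma Kdot_pos (gamma cv S0 : R) (Um Up : gas_state) :
  1 < gamma -> background_shock gamma cv S0 Um Up -> 0 < Kdot gamma Um Up.
Proof.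
  intros hg hs.
  destruct (bs_polytropic_p _ _ _ _ _ hs) as [hrho hp].
  pose proof (bs_pressure_jump _ _ _ _ _ hs) as hj.
  pose proof (bs_normalized_p _ _ _ _ _ hs) as hq; unfold mass_flux in hq.
  assert (hp0 : 0 < pressure Up).
  { rewrite hp; apply Rmult_lt_0_compat; [apply Rmult_lt_0_compat; [lra |] |];
      apply exp_pos. }
  assert (hq0 : speed Up <> 0) by (intro e; rewrite e in hq; lra).
  unfold Kdot; apply Rmult_lt_0_compat; [exact hj |].
  apply Rplus_lt_0_compat; apply Rdiv_lt_0_compat; try lra.
  - apply Rmult_lt_0_compat; lra.
  - apply Rmult_lt_0_compat; [exact hrho | apply pow2_gt_0; exact hq0].
Qed.

Lemma is_derive_Rfun (L K : R) (g : R -> R) (x : R) :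
  continuity g -> is_derive (Rfun L K g) x (- K * g x).
Proof.
  intros hg.
  assert (hc : forall y, continuous g y)
    by (intro y; apply continuity_pt_filterlim, hg).
  assert (hI : is_derive (fun y => RInt g 0 y) x (g x)).
  { apply (is_derive_RInt g (fun y => RInt g 0 y) 0); [| apply hc].
    apply filter_forall; intro y; apply (@RInt_correct R_CompleteNormedModule).
    apply (@ex_RInt_continuous R_CompleteNormedModule); intros z _; apply hc. }
  unfold Rfun.
  evar_last.
  - apply (is_derive_minus (V := R_NormedModule)).
    + apply is_derive_const.
    + apply is_derive_scal, hI.
  - change (0 - K * g x = - K * g x); ring.
Qed.

Lemma Rfun_ext_seg (L K : R) (f g : R -> R) :
  (forall x, 0 <= x <= L -> f x = g x) ->
  forall x, 0 <= x <= L -> Rfun L K f x = Rfun L K g x.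
Proof.
  intros h x hx; unfold Rfun.
  assert (hI : forall y, 0 <= y <= L -> RInt f 0 y = RInt g 0 y).
  { intros y hy; apply RInt_ext; intros z hz.
    rewrite Rmin_left, Rmax_right in hz by lra; apply h; lra. }
  rewrite (hI L), (hI x) by lra; reflexivity.
Qed.

Theorem lemma3p5
  (L alpha : R) (P Theta : R -> R)
  (gamma cv S0 : R) (Um Up : gas_state)
  (hL : 0 < L)
  (halpha : 0 < alpha < 1)
  (hP : C2alpha (half_line 0) alpha P)
  (hTheta : C2alpha (closed_seg 0 L) alpha Theta)
  (hTheta_norm : C2alpha_norm (closed_seg 0 L) alpha Theta = Finite 1)
  (hTheta0 : Theta 0 = 0)
  (hTheta1 : derive_on (closed_seg 0 L) Theta 0 = 0)
  (hTheta2 :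
     derive_on (closed_seg 0 L) (derive_on (closed_seg 0 L) Theta) 0 = 0)
  (hgamma : 1 < gamma)
  (hcv : 0 < cv)
  (hshock : background_shock gamma cv S0 Um Up)
  (hTheta_neq0 : forall xi, 0 < xi < L -> Theta xi <> 0) :
  let K := Kdot gamma Um Up in
  let Rf := Rfun L K Theta in
  let Pstar := Pdot_star gamma Up P in
  Rbar_le (inf_open L Rf) Pstar -> Rbar_le Pstar (sup_open L Rf) ->
  (exists! xi, 0 <= xi <= L /\ Pstar = Rf xi) /\
  (Rbar_lt (inf_open L Rf) Pstar -> Rbar_lt Pstar (sup_open L Rf) ->
     exists! xi, 0 < xi < L /\ Pstar = Rf xi) /\
  (forall xi, 0 < xi < L -> Pstar = Rf xi ->
     is_derive Rf xi (- K * Theta xi) /\ - K * Theta xi <> 0).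
Proof.
  intros K Rf Pstar hinf hsup.
  assert (hK : 0 < K) by exact (Kdot_pos _ _ _ _ _ hgamma hshock).
  set (g := fun x => Theta (clamp 0 L x)).
  assert (hgT : forall x, 0 <= x <= L -> Theta x = g x).
  { intros x hx; unfold g; rewrite clamp_id by lra; reflexivity. }
  assert (hg : continuity g).
  { apply continuous_clamp; [lra |]; intros x hx.
    destruct (proj1 hTheta x hx) as [l hl].
    exact (cont_deriv _ _ _ _ hl). }
  set (H := Rfun L K g).
  assert (hRH : forall x, 0 <= x <= L -> Rf x = H x)
    by exact (Rfun_ext_seg L K Theta g hgT).
  assert (hH : forall x, is_derive H x (- K * g x))
    by (intro x; apply is_derive_Rfun; exact hg).
  assert (hHc : continuity H).
  { intro x; apply derivable_continuous_pt; exists (- K * g x).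
    apply is_derive_Reals, hH. }
  assert (hn : forall x, 0 < x < L -> - K * Theta x <> 0).
  { intros x hx; apply Rmult_integral_contrapositive_currified; [lra |].
    apply hTheta_neq0; exact hx. }
  assert (hinj : forall u v, 0 <= u <= L -> 0 <= v <= L -> H u = H v -> u = v).
  { apply (injective_of_derive_neq0 H (fun x => - K * g x)); [exact hH |].
    intros x hx; rewrite <- hgT by lra; apply hn; exact hx. }
  assert (hbd : forall x, 0 < x < L ->
            Rmin (H 0) (H L) <= Rf x <= Rmax (H 0) (H L)).
  { intros x hx; rewrite hRH by lra; apply injective_between_endpoints; assumption. }
  assert (hlo : Rbar_le (Rmin (H 0) (H L)) (inf_open L Rf))
    by (apply inf_open_ge; intros x hx; apply hbd; exact hx).
  assert (hhi : Rbar_le (sup_open L Rf) (Rmax (H 0) (H L)))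
    by (apply sup_open_le; intros x hx; apply hbd; exact hx).
  destruct (IVT_gen H 0 L Pstar hHc) as [z [hz ez]].
  { split.
    - exact (Rbar_le_trans _ _ _ hlo hinf).
    - exact (Rbar_le_trans _ _ _ hsup hhi). }
  rewrite Rmin_left, Rmax_right in hz by lra.
  assert (huniq : forall y, 0 <= y <= L -> Pstar = Rf y -> z = y).
  { intros y hy e; apply hinj; [exact hz | exact hy |].
    rewrite <- (hRH y hy), ez; exact e. }
  split; [| split].
  - exists z; split.
    + split; [exact hz | rewrite hRH by exact hz; symmetry; exact ez].
    + intros y [hy e]; apply huniq; assumption.
  - intros hinf' hsup'.
    assert (h1 : Rmin (H 0) (H L) < Pstar)
      by exact (Rbar_le_lt_trans _ _ _ hlo hinf').
    assert (h2 : Pstar < Rmax (H 0) (H L))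
      by exact (Rbar_lt_le_trans _ _ _ hsup' hhi).
    (* A level strictly between the end values is attained at neither end. *)
    assert (hz0 : z <> 0).
    { intros e; rewrite <- ez, e in h1, h2; revert h1 h2.
      unfold Rmin, Rmax; destruct Rle_dec; lra. }
    assert (hzL : z <> L).
    { intros e; rewrite <- ez, e in h1, h2; revert h1 h2.
      unfold Rmin, Rmax; destruct Rle_dec; lra. }
    exists z; split.
    + split; [lra | rewrite hRH by exact hz; symmetry; exact ez].
    + intros y [hy e]; apply huniq; [lra | exact e].
  - intros x hx _; split; [| apply hn; exact hx].
    rewrite hgT by lra.
    apply (is_derive_ext_loc H); [| apply hH].
    apply (locally_interval _ x 0 L); simpl; try lra.
    intros y hy0 hyL; symmetry; apply hRH; lra.
Qed.
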